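(* Let $n,M$ be positive integers, let $q_1,\dots,q_n\ge0$ be real numbers with $\sum_{j=1}^n q_j=M$, let $0\le\rho\le1$, and put $q_j^\rho=\frac{q_j}{M}(M+2\rho-1)$ for $1\le j\le n$. Let $p\ge1$ be a real number and let $$\psi(\mathbf m)=\sum_{j=1}^n|q_j^\rho-m_j|^p .$$ Then the algorithm MinimalSolution with the decomposable error function $\psi$ yields the $\rho$-rounding method; that is, the set of seat vectors output by MinimalSolution for $\psi$ is equal to the set of seat vectors produced by the $\rho$-rounding method for the exact quotas $(q_1,\dots,q_n)$.
   Context: $\mathbb N=\{0,1,2,\dots\}$, and $\mathcal M=\{(m_1,\dots,m_n)\in\mathbb Z^n: m_j\ge0,\ \sum_j m_j=M\}$ is the set of possible allocations of $M$ seats to $n$ parties; $q_j$ is the exact quota of party $j$. Decomposable error function: a function $\psi:\mathcal M\to\mathbb R_{\ge0}$ of the form $\psi(\mathbf m)=\sum_{j=1}^n\varphi_j(m_j)$ with $\varphi_j:\mathbb N\to\mathbb R_{\ge0}$ such that $H_j(\ell)=\varphi_j(\ell)-\varphi_j(\ell-1)$, $\ell\ge1$, is (weakly) increasing in $\ell$ for each $j$. Here $\varphi_j(x)=|x-q_j^\rho|^p$. Algorithm MinimalSolution for $\psi$: it outputs the vectors $\mathbf m\in\mathcal M$ such that the multiset $\{H_j(\ell):1\le\ell\le m_j,\ 1\le j\le n\}$ is the multiset of the $M$ smallest entries, counted with multiplicity, of the $M\times n$ matrix with entry $H_j(\ell)$ in row $\ell$, column $j$ (several output vectors are possible in case of ties).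 $\rho$-rounding method: let $\mu_j^\rho=\lfloor q_j^\rho\rfloor$, $r_j^\rho=q_j^\rho-\mu_j^\rho$, and $R=M-\sum_{j=1}^n\mu_j^\rho$. One first allocates $\mu_j^\rho$ seats to party $j$. If $R\ge0$, the $R$ remaining seats are given, one each, to $R$ parties with the largest remainders $r_j^\rho$ (ties broken arbitrarily): $m_j=\mu_j^\rho+1$ for $j\in J$ and $m_j=\mu_j^\rho$ for $j\notin J$, where $J\subseteq\{1,\dots,n\}$, $|J|=R$, and $r_j^\rho\ge r_k^\rho$ for all $j\in J$, $k\notin J$. If $R=-1$ (which can only occur when $\rho=1$ and all $q_j^\rho$ are integers), one seat is taken away from one arbitrarily chosen party among those with $\mu_j^\rho>q_j$. The set of seat vectors produced by the method is the set of all $(m_1,\dots,m_n)$ arising from all possible arbitrary choices. *)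

(* Defs.v *)
From HB Require Import structures.
From mathcomp Require Import all_boot all_order all_algebra.
From mathcomp Require Import classical_sets reals.
Set Implicit Arguments.
Unset Strict Implicit.
Unset Printing Implicit Defensive.
Import Order.TTheory GRing.Theory Num.Theory.
Local Open Scope classical_set_scope.
Local Open Scope ring_scope.

Definition allocations (n M : nat) : set {ffun 'I_n -> nat} :=
  [set m | (\sum_(j < n) m j)%N = M].

(* H_j(l); only meant for l >= 1, as 0.-1 = 0. *)
Definition increment (R : realType) (n : nat) (phi : 'I_n -> nat -> R)
  (j : 'I_n) (l : nat) : R := phi j l - phi j l.-1.

(* psi is a decomposable error function on [allocations n M], with summands
   phi; the values of psi outside [allocations n M] are irrelevant. *)
Definition decomposable_error (R : realType) (n M : nat)
  (psi : {ffun 'I_n -> nat} -> R) (phi : 'I_n -> nat -> R) : Prop :=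
  [/\ forall m, allocations M m -> psi m = \sum_(j < n) phi j (m j),
      forall j l, 0 <= phi j l
    & forall j l l', (1 <= l <= l')%N -> increment phi j l <= increment phi j l'].

(* Row l of the matrix, counted from 0, holds the increments H_j(l + 1). *)
Definition increment_mx (R : realType) (n M : nat) (phi : 'I_n -> nat -> R) :
  'M[R]_(M, n) := \matrix_(l < M, j < n) increment phi j l.+1.

Definition smallest_entries (R : realType) (n M : nat) (A : 'M[R]_(M, n)) :
  seq R :=
  take M (sort <=%R [seq A l j | l <- enum 'I_M, j <- enum 'I_n]).

(* Multisets are represented by sequences up to permutation. *)
Definition MinimalSolution (R : realType) (n M : nat)
  (phi : 'I_n -> nat -> R) : set {ffun 'I_n -> nat} :=
  [set m | allocations M m /\
     perm_eq [seq increment phi j l | j <- enum 'I_n, l <- iota 1 (m j)]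
             (smallest_entries (increment_mx M phi))].

Definition rho_quota (R : realType) (n M : nat) (q : 'I_n -> R) (rho : R)
  (j : 'I_n) : R := q j / M%:R * (M%:R + 2 * rho - 1).

Definition rho_floor (R : realType) (n M : nat) (q : 'I_n -> R) (rho : R)
  (j : 'I_n) : int := Num.floor (rho_quota M q rho j).

Definition rho_remainder (R : realType) (n M : nat) (q : 'I_n -> R) (rho : R)
  (j : 'I_n) : R := rho_quota M q rho j - (rho_floor M q rho j)%:~R.

(* Integer-valued: the number of remaining seats may be -1. *)
Definition rho_remaining (R : realType) (n M : nat) (q : 'I_n -> R) (rho : R) :
  int := M%:Z - \sum_(j < n) rho_floor M q rho j.

Definition rho_rounding (R : realType) (n M : nat) (q : 'I_n -> R) (rho : R) :
  set {ffun 'I_n -> nat} :=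
  let mu := rho_floor M q rho in
  let r := rho_remainder M q rho in
  [set m |
     (0 <= rho_remaining M q rho /\
      exists J : {set 'I_n},
        [/\ #|J|%:Z = rho_remaining M q rho,
            forall j k, j \in J -> k \notin J -> r k <= r j
          & forall j, (m j)%:Z = if j \in J then mu j + 1 else mu j])
  \/ (rho_remaining M q rho = -1 /\
      exists2 i : 'I_n, q i < (mu i)%:~R
        & forall j, (m j)%:Z = if j == i then mu j - 1 else mu j)].

(* Main.v *)
Require Import Defs.
From HB Require Import structures.
From mathcomp Require Import all_boot all_order all_algebra.
From mathcomp Require Import classical_sets reals exp.
From mathcomp Require Import boolp interval_inference convex hoelder.
From mathcomp Require Import zify ring lra.
Set Implicit Arguments.
Unset Strict Implicit.
Unset Printing Implicit Defensive.
Import Order.TTheory GRing.Theory Num.Theory.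
Local Open Scope classical_set_scope.
Local Open Scope ring_scope.

(** Write c_j for the rho-quota, D x = |x + 1|^p - |x|^p and d_j = m_j - c_j, so
that H_j(m_j) = D(d_j - 1), H_j(m_j + 1) = D(d_j) and the d_j sum up to
1 - 2 rho, which lies in [-1, 1]. Since the H_j are nondecreasing, an allocation
m is an output of MinimalSolution iff D(d_i - 1) <= D(d_j) for all i <> j with
m_i > 0. Now D is at most -1 on ]-oo, -1], strictly increasing from -1 to 1 on
[-1, 0], and at least 1 on [0, +oo[. For p = 1 there are ties outside [-1, 0],
but the constraint on the sum of the d_j makes them harmless: apart from the
case R = -1, every d_j lies in ]-1, 1], i.e. m_j is floor(c_j) or floor(c_j) + 1,
and the condition compares the values D(- r_j), hence the remainders. *)

(** * Selecting smallest entries, and optimality by exchange of one seat *)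

Lemma perm_take_sort (d : Order.disp_t) (T : orderType d) (s t u : seq T) :
  perm_eq u (s ++ t) ->
  perm_eq s (take (size s) (sort <=%O u)) = allrel <=%O s t.
Proof.
move=> u_st; have pst : perm_eq (sort <=%O u) (s ++ t) by rewrite perm_sort.
apply/idP/idP => [s_take|s_le_t].
- have t_drop : perm_eq t (drop (size s) (sort <=%O u)).
    rewrite -(perm_cat2l s) perm_sym -(permPr pst).
    rewrite -[X in perm_eq _ X](cat_take_drop (size s)).
    by rewrite perm_cat2r.
  have := sort_le_sorted u.
  rewrite le_sorted_pairwise -[X in pairwise _ X](cat_take_drop (size s)).
  rewrite pairwise_cat => /and3P[/allrelP le_td _ _].
  apply/allrelP => x y xs yt.
  by apply: le_td; rewrite -?(perm_mem s_take) -?(perm_mem t_drop).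
(* A sorted permutation of [u] is unique, and sorting the two blocks separately already yields one
   when [s] lies below [t]. *)
- have -> : sort <=%O u = sort <=%O s ++ sort <=%O t.
    apply: (sorted_eq le_trans le_anti); first exact: sort_le_sorted.
      rewrite le_sorted_pairwise pairwise_cat -!le_sorted_pairwise.
      rewrite !sort_le_sorted !andbT.
      apply/allrelP => x y; rewrite !mem_sort => xs yt.
      exact: (allrelP s_le_t).
    by rewrite (permPl pst) perm_sym perm_cat // perm_sort.
  by rewrite take_size_cat ?size_sort // perm_sym perm_sort.
Qed.

Lemma perm_allpairsC (S T U : eqType) (f : S -> T -> U) (s : seq S)
    (t : seq T) :
  perm_eq [seq f x y | x <- s, y <- t] [seq f x y | y <- t, x <- s].
Proof.
elim: s => [|a s IHs] /=; first by elim: t.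
by rewrite perm_sym perm_allpairs_consr perm_cat2l perm_sym.
Qed.

(** An output must have every selected increment below every rejected one. By monotonicity along
    columns, only the last selected and the first rejected entry of each column matter, and pairs
    within one column are automatic. *)
Lemma MinimalSolutionP (R : realType) (n M : nat) (phi : 'I_n -> nat -> R)
    (m : {ffun 'I_n -> nat}) :
  (forall j l l', (1 <= l <= l')%N -> increment phi j l <= increment phi j l') ->
  MinimalSolution M phi m <->
  allocations M m /\
  forall i j, i != j -> (0 < m i)%N ->
    increment phi i (m i) <= increment phi j (m j).+1.
Proof.
move=> mono; rewrite /MinimalSolution /allocations /=.
suff E : (\sum_(j < n) m j)%N = M ->
  perm_eq [seq increment phi j l | j <- enum 'I_n, l <- iota 1 (m j)]
             (smallest_entries (increment_mx M phi)) <->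
  forall i j, i != j -> (0 < m i)%N ->
    increment phi i (m i) <= increment phi j (m j).+1.
  by split=> -[mM] /E-/(_ mM).
move=> mM; have m_le j : (m j <= M)%N by rewrite -mM (bigD1 j) //= leq_addr.
(* If another party holds a seat, the first rejected entry of column j still lies within the M
   rows. *)
have m_lt i j : i != j -> (0 < m i)%N -> (m j < M)%N.
  by move=> ij mi; rewrite -mM (bigD1 j) //= (bigD1 i) //=; lia.
set sel := [seq _ | j <- _, l <- _].
pose rej := [seq increment phi j l | j <- enum 'I_n,
  l <- iota (1 + m j) (M - m j)].
have size_sel : size sel = M.
  rewrite size_allpairs_dep -[RHS]mM sumnE big_map big_enum /=.
  by apply: eq_bigr => j _; rewrite size_iota.
rewrite /smallest_entries -{1}size_sel (@perm_take_sort _ _ _ rej); last first.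
  (* [sel] and [rej] together list the matrix by columns, whereas [smallest_entries] lists it by
     rows. *)
  rewrite perm_sym -perm_allpairs_catr perm_sym.
  have -> : [seq increment phi j l | j <- enum 'I_n,
      l <- iota 1 (m j) ++ iota (1 + m j) (M - m j)] =
      [seq increment phi j l | j <- enum 'I_n, l <- iota 1 M].
    by congr flatten; apply: eq_map => j; rewrite -iotaD subnKC.
  have -> : iota 1 M = [seq (val l).+1 | l <- enum 'I_M].
    by rewrite (map_comp S val) val_enum_ord -(iotaDl 1).
  rewrite allpairs_mapr.
  apply: perm_trans (perm_allpairsC _ _ _) _.
  suff -> : [seq increment_mx M phi l j | j <- enum 'I_n, l <- enum 'I_M] =
    [seq increment phi j (val l).+1 | j <- enum 'I_n, l <- enum 'I_M] by [].
  by congr flatten; apply: eq_map => j; apply: eq_map => l; rewrite mxE.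
split=> [/allrelP le_sel_rej i j ij mi|le_next].
  apply: le_sel_rej; apply/allpairsPdep.
    by exists i, (m i); rewrite mem_enum mem_iota; split=> //; lia.
  exists j, (m j).+1; rewrite mem_enum mem_iota; split=> //.
  by have := m_lt _ _ ij mi; lia.
apply/allrelP => x y.
move=> /allpairsPdep[i [l [_ + ->]]] /allpairsPdep[j [l' [_ + ->]]].
rewrite !mem_iota => hl hl'; have [ij|ij] := eqVneq i j.
  by subst j; apply: mono; lia.
apply: (@le_trans _ _ (increment phi i (m i))); first by apply: mono; lia.
apply: (@le_trans _ _ (increment phi j (m j).+1)); last by apply: mono; lia.
by apply: le_next => //; lia.
Qed.

(** * Bounds and monotonicity of D *)

Section AbsPowDiff.
Context {R : realType} (p : R).
Hypothesis p_ge1 : 1 <= p.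
Implicit Types x y : R.

Definition abs_pow_diff x := `|x + 1| `^ p - `|x| `^ p.

Let p_gt0 : 0 < p. Proof. exact: lt_le_trans ltr01 _. Qed.

(** Split [(1 + x) ^ p] as [(1 + x) ^ (p - 1) + x * (1 + x) ^ (p - 1)] and bound the powers below by
    1 and by [x ^ (p - 1)]. *)
Lemma powR_superadditive1 x : 0 <= x -> 1 + x `^ p <= (1 + x) `^ p.
Proof.
move=> x0; have x1 : 0 <= 1 + x by lra.
rewrite -(mulr_powRB1 x0 p_gt0) -(mulr_powRB1 x1 p_gt0) mulrDl mul1r.
have p1 : 0 <= p - 1 by rewrite subr_ge0.
have x1_ge1 : 1 <= 1 + x by lra.
apply: lerD; first by rewrite (le_trans _ (ler_powR x1_ge1 p1)) // powRr0.
apply: ler_wpM2l => //; apply: ge0_ler_powR => //; rewrite ?nnegrE //; lra.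
Qed.

Lemma abs_pow_diff_leN1 x : x <= -1 -> abs_pow_diff x <= -1.
Proof.
move=> x1; have := @powR_superadditive1 (- (x + 1)).
rewrite /abs_pow_diff (@ler0_norm _ (x + 1)) ?(@ler0_norm _ x); try lra.
have -> : 1 + - (x + 1) = - x by ring.
by move=> /(_ _); lra.
Qed.

Lemma abs_pow_diff_ge1 x : 0 <= x -> 1 <= abs_pow_diff x.
Proof.
move=> x0; have := powR_superadditive1 x0.
by rewrite /abs_pow_diff !ger0_norm ?(addrC 1 x); lra.
Qed.

Lemma abs_pow_diff0 : abs_pow_diff 0 = 1.
Proof.
by rewrite /abs_pow_diff add0r normr1 normr0 powR1 powR0 ?subr0 // gt_eqF.
Qed.

Lemma abs_pow_diffN1 : abs_pow_diff (-1) = -1.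
Proof.
by rewrite /abs_pow_diff addNr normrN normr1 normr0 powR1 powR0 ?sub0r // gt_eqF.
Qed.

(** On [-1, 0] the first power strictly increases while the subtracted one strictly decreases, even
    for p = 1. *)
Lemma abs_pow_diff_lt x y : -1 <= x -> x < y -> y <= 0 ->
  abs_pow_diff x < abs_pow_diff y.
Proof.
move=> x1 xy y0; rewrite /abs_pow_diff.
rewrite (@ger0_norm _ (x + 1)) ?(@ger0_norm _ (y + 1)); try lra.
rewrite (@ler0_norm _ x) ?(@ler0_norm _ y); try lra.
apply: ltrB.
  by apply: (gt0_ltr_powR p_gt0); rewrite ?nnegrE; lra.
by apply: (gt0_ltr_powR p_gt0); rewrite ?nnegrE; lra.
Qed.

Lemma abs_pow_diff_le x y : -1 <= x -> x <= y -> y <= 0 ->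
  abs_pow_diff x <= abs_pow_diff y.
Proof.
move=> x1; rewrite le_eqVlt => /predU1P[-> //|xy y0].
exact/ltW/abs_pow_diff_lt.
Qed.

Lemma abs_pow_diff_gtN1 x : -1 < x -> -1 < abs_pow_diff x.
Proof.
move=> x1; have [x0|x0] := leP x 0; last first.
  by have := abs_pow_diff_ge1 (ltW x0); lra.
by rewrite -[ltLHS]abs_pow_diffN1 abs_pow_diff_lt.
Qed.

Lemma abs_pow_diff_geN1 x : -1 <= x -> -1 <= abs_pow_diff x.
Proof.
rewrite le_eqVlt => /predU1P[<-|/abs_pow_diff_gtN1/ltW //].
by rewrite abs_pow_diffN1.
Qed.

Lemma abs_pow_diff_lt1 x : x < 0 -> abs_pow_diff x < 1.
Proof.
move=> x0; have [x1|x1] := leP x (-1).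
  by have := abs_pow_diff_leN1 x1; lra.
by rewrite -[ltRHS]abs_pow_diff0 abs_pow_diff_lt // ltW.
Qed.

Lemma abs_pow_diff_le1 x : x <= 0 -> abs_pow_diff x <= 1.
Proof.
rewrite le_eqVlt => /predU1P[->|/abs_pow_diff_lt1/ltW //].
by rewrite abs_pow_diff0.
Qed.

(** Midpoint convexity of the p-th power of the absolute value at x, x + 1, x + 2. Unit steps
    suffice, since each [H_j] samples D at points one apart. *)
Lemma abs_pow_diff_le_succ x : abs_pow_diff x <= abs_pow_diff (x + 1).
Proof.
rewrite /abs_pow_diff.
have half_ge0 : (0 : R) <= 2^-1 by lra.
have half_le1 : (2^-1 : R) <= 1 by lra.
have cvx : (2^-1 * `|x| + (1 - 2^-1) * `|x + 1 + 1|) `^ p <=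
    2^-1 * `|x| `^ p + (1 - 2^-1) * `|x + 1 + 1| `^ p.
  by apply: (convex_powR p_ge1 (Itv01 half_ge0 half_le1));
    rewrite inE /= in_itv /= normr_ge0.
suff : `|x + 1| `^ p <= (2^-1 * `|x| + (1 - 2^-1) * `|x + 1 + 1|) `^ p by lra.
have mid : `|x + 1| <= 2^-1 * `|x| + (1 - 2^-1) * `|x + 1 + 1|.
  have [] := ger0P x; have [] := ger0P (x + 1);
    by have [] := ger0P (x + 1 + 1); lra.
by apply: ge0_ler_powR; rewrite ?nnegrE ?(le_trans _ mid) // ltW.
Qed.

Lemma abs_pow_diff_le_nat x (k : nat) :
  abs_pow_diff x <= abs_pow_diff (x + k%:R).
Proof.
elim: k => [|k IHk]; first by rewrite addr0.
by rewrite (le_trans IHk) // -natr1 addrA abs_pow_diff_le_succ.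
Qed.

End AbsPowDiff.

(** * Increments of the summands of psi *)

Section DistPow.
Context {R : realType} (n : nat) (c : 'I_n -> R) (p : R).
Hypothesis p_ge1 : 1 <= p.

Definition dist_pow (j : 'I_n) (x : nat) : R := `|x%:R - c j| `^ p.

Lemma increment_dist_pow j l :
  increment dist_pow j l.+1 = abs_pow_diff p (l%:R - c j).
Proof. by rewrite /increment /dist_pow /abs_pow_diff -natr1 addrAC. Qed.

Lemma le_increment_dist_pow j l l' : (1 <= l <= l')%N ->
  increment dist_pow j l <= increment dist_pow j l'.
Proof.
case: l l' => [|l] [|l'] //= /[!ltnS] ll'; rewrite !increment_dist_pow.
by rewrite -(subnKC ll') natrD addrAC; exact: abs_pow_diff_le_nat.
Qed.

End DistPow.

(** * Optimal allocations versus rho-rounding *)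

Theorem corollary6p6 (R : realType) (n M : nat) (n_gt0 : (0 < n)%N)
  (M_gt0 : (0 < M)%N) (q : 'I_n -> R) (q_ge0 : forall j, 0 <= q j)
  (q_sum : \sum_(j < n) q j = M%:R) (rho : R) (rho_ge0 : 0 <= rho)
  (rho_le1 : rho <= 1) (p : R) (p_ge1 : 1 <= p) :
  let qrho := rho_quota M q rho in
  let phi := fun (j : 'I_n) (x : nat) => `|x%:R - qrho j| `^ p in
  let psi := fun m : {ffun 'I_n -> nat} =>
    \sum_(j < n) `|qrho j - (m j)%:R| `^ p in
  decomposable_error M psi phi /\
  MinimalSolution M phi = rho_rounding M q rho.
Proof.
move=> c phi psi.
have mono j l l' : (1 <= l <= l')%N -> increment phi j l <= increment phi j l'.
  exact: (le_increment_dist_pow c p_ge1).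
split.
  split=> // [m _|j l]; last exact: powR_ge0.
  by apply: eq_bigr => j _; rewrite distrC.
have M_ge1 : 1 <= M%:R :> R by rewrite ler1n.
have c_ge0 j : 0 <= c j.
  by apply: mulr_ge0; [apply: divr_ge0 => // | ]; lra.
have c_sum : \sum_j c j = M%:R + 2 * rho - 1.
  by rewrite -!mulr_suml q_sum divff ?mul1r //; lra.
(* The rho-quotas being nonnegative, their floors are natural numbers and the absolute value changes
   nothing. *)
pose a j := `|rho_floor M q rho j|%N.
have floor_c j : rho_floor M q rho j = (a j)%:Z.
  by rewrite gez0_abs // /rho_floor floor_ge0 c_ge0.
have c_itv j : (a j)%:R <= c j < (a j)%:R + 1.
  have := floor_itv (c j).
  by rewrite -/(rho_floor M q rho j) floor_c intrD.
have remainderE j : rho_remainder M q rho j = c j - (a j)%:R.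
  by rewrite /rho_remainder floor_c.
have remainingE : rho_remaining M q rho = M%:Z - (\sum_j a j)%N%:Z.
  rewrite /rho_remaining (big_morph Posz PoszD (erefl 0)); congr (_ - _).
  by apply: eq_bigr => j _; rewrite floor_c.
pose D := abs_pow_diff p.
have incD j l : increment phi j l.+1 = D (l%:R - c j).
  exact: increment_dist_pow.
have d_sum (m : {ffun 'I_n -> nat}) : allocations M m ->
    \sum_j ((m j)%:R - c j) = 1 - 2 * rho.
  by rewrite /allocations /= => mM; rewrite sumrB c_sum -natr_sum mM; lra.
have incE i (m : {ffun 'I_n -> nat}) : (0 < m i)%N ->
    increment phi i (m i) = D ((m i)%:R - c i - 1).
  by case: (m i) => // l _; rewrite incD -natr1; congr D; ring.
have optP m : MinimalSolution M phi m <-> allocations M m /\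
    forall i j, i != j -> (0 < m i)%N ->
      D ((m i)%:R - c i - 1) <= D ((m j)%:R - c j).
  rewrite MinimalSolutionP //; split=> -[mM opt]; split=> // i j ij mi.
    by have := opt i j ij mi; rewrite incE // incD.
  by rewrite incE // incD; exact: opt.
have m_gt0 (m : {ffun 'I_n -> nat}) i : 0 < (m i)%:R - c i -> (0 < m i)%N.
  by case: (m i) => // ; have := c_ge0 i; lra.
have a_uniq j (k : nat) : c j = k%:R -> a j = k.
  move=> cj; have := c_itv j; rewrite cj natr1 ler_nat ltr_nat; lia.
have card_sum (J : {set 'I_n}) : (\sum_k (k \in J) = #|J|)%N.
  by rewrite -sum1_card [RHS]big_mkcond.
apply/seteqP; split=> m.
- move=> /optP[mM opt]; have dM := d_sum _ mM.
  (* An entry d_j <= -1 forces all d_i <= 0; as the d_i sum up to 1 - 2 rho,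
     this leaves d_j = -1, all other d_i = 0 and rho = 1, the case R = -1. *)
  have [[j dj]|dgt] := pselect (exists j, (m j)%:R - c j <= -1).
  + right.
    have d_le0 i : (m i)%:R - c i <= 0.
      rewrite leNgt; apply/negP => di.
      have ij : i != j by apply: contraTneq di => ->; rewrite -leNgt; lra.
      (* [d_i > 0] would give D(d_i - 1) > -1 >= D(d_j), against optimality. *)
      have := opt i j ij (m_gt0 _ _ di).
      have := abs_pow_diff_leN1 p_ge1 dj.
      have : -1 < D ((m i)%:R - c i - 1) by apply: abs_pow_diff_gtN1 => //; lra.
      rewrite -/D; lra.
    have rest_le0 (P : pred 'I_n) : \sum_(k | P k) ((m k)%:R - c k) <= 0.
      by apply: sumr_le0.
    have [{}dj rho1] : (m j)%:R - c j = -1 /\ rho = 1.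
      move: dM; rewrite (bigD1 j) //=; have := rest_le0 (fun k => k != j).
      by split; lra.
    have d0 k : k != j -> (m k)%:R - c k = 0.
      move=> kj; move: dM; rewrite (bigD1 j) //= (bigD1 k) //=.
      have := rest_le0 (fun l => (l != j) && (l != k)); have := d_le0 k; lra.
    have aj : a j = (m j).+1 by apply: a_uniq; rewrite -natr1; lra.
    have ak k : k != j -> a k = m k by move=> /d0 dk; apply: a_uniq; lra.
    split.
      rewrite remainingE; suff -> : (\sum_k a k)%N = M.+1 by lia.
      rewrite (bigD1 j) //= aj (eq_bigr _ ak) addSn; congr _.+1.
      by rewrite -mM [RHS](bigD1 j).
    exists j.
      rewrite floor_c aj.
      have -> : (Posz (m j).+1)%:~R = c j by rewrite -[LHS]natr1; lra.
      (* For rho = 1 the quota is scaled by 1 + 1/M, so [q j < c j] unless [q j = 0]; then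
         [c j = 0], which contradicts d_j = -1. *)
      have cj : c j = q j + q j / M%:R.
        by rewrite /c /rho_quota rho1; field; rewrite pnatr_eq0 -lt0n.
      rewrite cj ltrDl divr_gt0 ?ltr0n // lt0r q_ge0 andbT.
      apply/negP => /eqP qj; move: cj; rewrite qj mul0r addr0 => cj.
      by move: dj; have := ler0n R (m j); lra.
    move=> k; rewrite floor_c; have [->|/ak -> //] := eqVneq k j.
    by rewrite aj; lia.
  + have {}dgt j : -1 < (m j)%:R - c j.
      by rewrite ltNge; apply/negP => dj; apply: dgt; exists j.
    (* An entry d_i > 1 forces all d_k >= 0, so that the sum exceeds 1. *)
    have d_le1 i : (m i)%:R - c i <= 1.
      rewrite leNgt; apply/negP => di.
      suff d_ge0 k : 0 <= (m k)%:R - c k.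
        move: dM; rewrite (bigD1 i) //=.
        have : 0 <= \sum_(k | k != i) ((m k)%:R - c k) by apply: sumr_ge0.
        lra.
      rewrite leNgt; apply/negP => dk.
      have ik : i != k by apply: contraTneq dk => <-; rewrite -leNgt; lra.
      have mi : (0 < m i)%N by apply: m_gt0; lra.
      (* Here D(d_k) < 1 <= D(d_i - 1), against optimality. *)
      have := opt i k ik mi; have := abs_pow_diff_lt1 p_ge1 dk.
      have : 1 <= D ((m i)%:R - c i - 1) by apply: abs_pow_diff_ge1 => //; lra.
      rewrite -/D; lra.
    have m_a k : (a k <= m k <= (a k).+1)%N.
      have /andP[ak ck] := c_itv k.
      have h1 : (a k < (m k).+1)%N.
        by rewrite -(ltr_nat R) -natr1; have := dgt k; lra.
      have h2 : (m k < (a k).+2)%N.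
        by rewrite -(ltr_nat R) -!natr1; have := d_le1 k; lra.
      by lia.
    pose J := [set j | a j < m j]%N%SET.
    have mJ k : m k = (a k + (k \in J))%N.
      by rewrite inE; have := m_a k; case: ltnP; lia.
    have J_rem : #|J|%:Z = rho_remaining M q rho.
      rewrite remainingE -mM (eq_bigr _ (fun k _ => mJ k)) big_split /=.
      by rewrite card_sum PoszD addrAC subrr add0r.
    left; split; first by rewrite -J_rem.
    exists J; split=> // [j k jJ kJ|j]; last first.
      by rewrite floor_c mJ; case: ifP; lia.
    rewrite !remainderE leNgt; apply/negP => r_lt.
    have jk : j != k by apply: contraNneq kJ => <-.
    have mj : m j = (a j).+1 by rewrite mJ jJ addn1.
    have mk : m k = a k by rewrite mJ (negbTE kJ) addn0.
    (* Optimality says D(- r_j) <= D(- r_k), but r_j < r_k gives the strict reverse on [-1, 0]. *)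
    have := opt j k jk; rewrite mj mk => /(_ isT).
    have := c_itv j; have := c_itv k => ck cj.
    apply/negP; rewrite -ltNge -natr1; apply: abs_pow_diff_lt => //; lra.
- case=> [[_ [J [J_rem J_max mJ]]]|[rem_N1 [i0 qi0 m_i0]]]; apply/optP.
  + have {}mJ k : m k = (a k + (k \in J))%N.
      by have := mJ k; rewrite floor_c; case: ifP; lia.
    split.
      rewrite /allocations /= (eq_bigr _ (fun k _ => mJ k)) big_split /=.
      rewrite card_sum; move: J_rem; rewrite remainingE => /eqP.
      by rewrite eq_sym subr_eq -PoszD addnC => /eqP[/esym].
    move=> i j ij mi; rewrite !mJ !natrD.
    have := c_itv i; have := c_itv j => cj ci.
    (* If i is not in J, the value -1 separates the two sides; if both are in J, the value 1 does;
       otherwise D(- r_i) and D(- r_j) are compared through the remainders. *)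
    case: (boolP (i \in J)) => iJ /=; last first.
      apply: (@le_trans _ _ (-1)); first by apply: abs_pow_diff_leN1; lra.
      apply: abs_pow_diff_geN1 => //; have := ler0n R (j \in J); lra.
    case: (boolP (j \in J)) => jJ /=.
      apply: (@le_trans _ _ 1); first by apply: abs_pow_diff_le1; lra.
      by apply: abs_pow_diff_ge1; lra.
    have := J_max i j iJ jJ; rewrite !remainderE => rji.
    by apply: abs_pow_diff_le => //; lra.
  + have a_sum : (\sum_k a k)%N = M.+1 by move: rem_N1; rewrite remainingE; lia.
    have {}m_i0 k : a k = (m k + (k == i0))%N.
      by have := m_i0 k; rewrite floor_c; case: ifP; lia.
    (* The floors sum to M + 1 and the rho-quotas to at most M + 1, so no fractional part is
       left. *)
    have c_a k : c k = (a k)%:R.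
      have rest_ge0 : 0 <= \sum_(l | l != k) (c l - (a l)%:R).
        by apply: sumr_ge0 => l _; have := c_itv l; lra.
      have : \sum_l (c l - (a l)%:R) <= 0.
        by rewrite sumrB c_sum -natr_sum a_sum -natr1; lra.
      by rewrite (bigD1 k) //=; have := c_itv k; lra.
    split.
      move: a_sum; rewrite (eq_bigr _ (fun k _ => m_i0 k)) big_split /=.
      by rewrite -big_mkcond /= big_pred1_eq /allocations /=; lia.
    (* All d_k are now 0 or -1, hence D(d_i - 1) <= -1 <= D(d_j). *)
    move=> i j ij mi; rewrite !c_a !m_i0 !natrD.
    have := ler0n R (i == i0); have := ler0n R (j == i0).
    have : (j == i0)%:R <= 1 :> R by case: (j == i0).
    move=> h1 h2 h3; apply: (@le_trans _ _ (-1)).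
      by apply: abs_pow_diff_leN1 => //; lra.
    by apply: abs_pow_diff_geN1 => //; lra.
Qed.
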